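(* Let $V$ be a finite-dimensional complex vector space and let $A$ be a linear transformation on $V$. Every invertible linear transformation in $(A)'$ is in $\mathrm{Col}(A)$.
   Context: $(A)'=\{T:\ TA=AT\}$ is the commutant of $A$ in the algebra of all linear transformations on $V$. $\mathrm{Lat}(A)$ is the lattice of all subspaces $M\subseteq V$ with $AM\subseteq M$. $\mathrm{Col}(A)$ is the group of all invertible linear transformations $S$ on $V$ such that for every subspace $M$ of $V$ one has $M\in\mathrm{Lat}(A)\iff SM\in\mathrm{Lat}(A)$. *)

(* Defs.v *)
From HB Require Import structures.
From mathcomp Require Import all_boot all_order all_algebra.
From mathcomp Require Import classical_sets reals complex.

Set Implicit Arguments.
Unset Strict Implicit.
Unset Printing Implicit Defensive.

Import GRing.Theory.

Local Open Scope ring_scope.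
Local Open Scope classical_set_scope.
Local Open Scope complex_scope.

Section LinearTransformations.
Variables (R : realType) (V : vectType R[i]).
Implicit Types (A S T : 'End(V)) (M : {vspace V}).

(* Stated with an explicit inverse rather than with [GRing.unit]: ['End(V)] is
   a (nontrivial) unit ring only when V is nonzero, and V = 0 is allowed. *)
Definition invertible S : Prop :=
  exists T, (T \o S = \1)%VF /\ (S \o T = \1)%VF.

Definition commutant A : set 'End(V) := [set T | (T \o A = A \o T)%VF].

Definition Lat A : set {vspace V} := [set M | (A @: M <= M)%VS].

Definition Col A : set 'End(V) :=
  [set S | invertible S /\ forall M, Lat A M <-> Lat A (S @: M)%VS].

End LinearTransformations.

(* Main.v *)
Require Import Defs.
From HB Require Import structures.
From mathcomp Require Import all_boot all_order all_algebra.
From mathcomp Require Import classical_sets reals complex.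

Local Open Scope ring_scope.
Local Open Scope complex_scope.

(** Since [S] commutes with [A], invariance of [S @: M] under [A] reads [S @: (A @: M) <= S @: M].
    Taking images under [S] preserves inclusions and, [S] having a left inverse [T], also reflects
    them, so this is equivalent to [A @: M <= M]. *)

Theorem proposition2 (R : realType) (V : vectType R[i]) (A S : 'End(V)) :
  commutant A S -> invertible S -> Col A S.
Proof.
rewrite /commutant /Col /Lat /= => SA S_inv; split=> // M.
case: S_inv => T [TS _]; rewrite -limg_comp -SA limg_comp.
split=> [|SAM]; first exact: limgS.
have TSK U : (T @: (S @: U))%VS = U by rewrite -limg_comp TS lim1g.
(* Apply [T] to both sides of [SAM]. Expanding [M] also hits the copy inside [A @: M]; the final
   [TSK] undoes that. *)
by rewrite -(TSK (A @: M)%VS) -(TSK M) limgS // TSK.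
Qed.
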